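(* Let $f,u\colon\mathbb{R}^n\to\mathbb{R}$ be directionally differentiable in the sense of Hadamard, let $\Omega=\{x\in\mathbb{R}^n\mid u(x)\le 0\}$ and let $x_\ast\in\Omega$. Suppose that the regularity condition $\operatorname{cl}\{K_{<}(x_\ast)\}=K_{\le}(x_\ast)$ holds at $x_\ast$. Let $E_{\ast}(f)$ be a lower exhauster of $f$ at $x_\ast$ in the sense of Hadamard and let $E^{\ast}(u)$ be an upper exhauster of $u$ at $x_\ast$ in the sense of Hadamard. If $x_\ast$ is a local minimum of $f$ on $\Omega$, then $$\bigcup_{C\in E^{\ast}(u)}\left[-K^+(C)\right]\subset \bigcup_{C\in E_{\ast}(f)}K^+(C).$$
   Context: A function $\varphi\colon\mathbb{R}^n\to\mathbb{R}$ is directionally differentiable in the sense of Hadamard at $x$ if for every $g\in\mathbb{R}^n$ the finite limit $\varphi'_H(x,g)=\lim_{[\alpha,g']\to[+0,g]}\frac{\varphi(x+\alpha g')-\varphi(x)}{\alpha}$ exists. A family $E^\ast(\varphi)$ of convex compact subsets of $\mathbb{R}^n$, totally bounded (i.e. all its members are contained in one common ball), is an upper exhauster of $\varphi$ at $x$ in the sense of Hadamard if $\varphi'_H(x,g)=\min_{C\in E^\ast(\varphi)}\max_{v\in C}\langle v,g\rangle$ for all $g\in\mathbb{R}^n$. A totally bounded family $E_\ast(\varphi)$ of convex compact subsets of $\mathbb{R}^n$ is a lower exhauster of $\varphi$ at $x$ in the sense of Hadamard if $\varphi'_H(x,g)=\max_{C\in E_\ast(\varphi)}\min_{w\in C}\langle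 w,g\rangle$ for all $g\in\mathbb{R}^n$. The minima and maxima over the families are attained. Members of the families are nonempty sets. For $x\in\mathbb{R}^n$, $K_{<}(x)=\{g\in\mathbb{R}^n\mid u'_H(x,g)<0\}$ and $K_{\le}(x)=\{g\in\mathbb{R}^n\mid u'_H(x,g)\le 0\}$. For a convex compact set $C$, $K(C)=\operatorname{cone}\{C\}$ is the conic hull of $C$, and $K^+(C)=\{g\in\mathbb{R}^n\mid\langle v,g\rangle\ge 0\ \forall v\in K(C)\}$ is the conjugate cone of $K(C)$. $\operatorname{cl}$ denotes closure. *)

(* Defs.v *)
From HB Require Import structures.
From mathcomp Require Import all_boot all_order all_algebra.
From mathcomp Require Import all_classical all_reals all_analysis.

Set Implicit Arguments.
Unset Strict Implicit.
Unset Printing Implicit Defensive.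

Import Order.TTheory GRing.Theory Num.Theory.
Import numFieldNormedType.Exports.

Local Open Scope classical_set_scope.
Local Open Scope ring_scope.

(* R^n is 'rV[R]_n with the library's topology and norm (the sup norm); only
   norm-independent notions (limits, closure, compactness, boundedness) are
   used. *)

Definition dot (R : realType) (n : nat) (v w : 'rV[R]_n) : R :=
  \sum_(i < n) v 0 i * w 0 i.

Definition is_minimum (R : realType) (A : set R) (m : R) : Prop :=
  A m /\ lbound A m.

Definition is_maximum (R : realType) (A : set R) (m : R) : Prop :=
  A m /\ ubound A m.

Section Hadamard.
Variables (R : realType) (n : nat).
Implicit Types (phi : 'rV[R]_n -> R) (x g : 'rV[R]_n).

Definition diff_quotient phi x (p : R * 'rV[R]_n) : R :=
  (phi (x + p.1 *: p.2) - phi x) / p.1.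

(* [alpha, g'] --> [+0, g]: alpha tends to 0 with alpha > 0, while g' may be
   equal to g *)
Definition hadamard_filter g : set_system (R * 'rV[R]_n) :=
  filter_prod (0 : R)^'+ (nbhs g).

Definition hadamard_derive phi x g : R :=
  lim (diff_quotient phi x @ hadamard_filter g).

Definition hadamard_differentiable phi x : Prop :=
  forall g, cvg (diff_quotient phi x @ hadamard_filter g).

End Hadamard.

Section Exhausters.
Variables (R : realType) (n : nat).
Implicit Types (phi : 'rV[R]_n -> R) (x g : 'rV[R]_n).
Implicit Types (C : set 'rV[R]_n) (E : set (set 'rV[R]_n)).

(* nonempty convex compact sets, all contained in one common ball *)
Definition convex_compact_family E : Prop :=
  (forall C, E C -> [/\ C !=set0, convex_set C & compact C]) /\
  bounded_set (\bigcup_(C in E) C).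

Definition upper_exhauster phi x E : Prop :=
  convex_compact_family E /\
  forall g, is_minimum
    [set m | exists2 C, E C & is_maximum [set dot v g | v in C] m]
    (hadamard_derive phi x g).

Definition lower_exhauster phi x E : Prop :=
  convex_compact_family E /\
  forall g, is_maximum
    [set m | exists2 C, E C & is_minimum [set dot w g | w in C] m]
    (hadamard_derive phi x g).

End Exhausters.

Section Cones.
Variables (R : realType) (n : nat).

Definition K_lt (u : 'rV[R]_n -> R) (x : 'rV[R]_n) : set 'rV[R]_n :=
  [set g | hadamard_derive u x g < 0].

Definition K_le (u : 'rV[R]_n -> R) (x : 'rV[R]_n) : set 'rV[R]_n :=
  [set g | hadamard_derive u x g <= 0].

Definition conic_hull (C : set 'rV[R]_n) : set 'rV[R]_n :=
  [set y | exists (k : nat) (a : 'I_k -> R) (v : 'I_k -> 'rV[R]_n),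
     [/\ forall i, 0 <= a i, forall i, C (v i) &
         y = \sum_(i < k) a i *: v i]].

Definition conjugate_cone (K : set 'rV[R]_n) : set 'rV[R]_n :=
  [set g | forall v, K v -> 0 <= dot v g].

Definition Kplus (C : set 'rV[R]_n) : set 'rV[R]_n :=
  conjugate_cone (conic_hull C).

End Cones.

Definition local_minimum_on (R : realType) (n : nat) (f : 'rV[R]_n -> R)
    (Omega : set 'rV[R]_n) (x : 'rV[R]_n) : Prop :=
  Omega x /\ \forall y \near x, Omega y -> f x <= f y.

(* Main.v *)
(* A direction h in -K^+(C) satisfies u'_H(x, h) <= max_(v in C) <v, h> <= 0, so
   by regularity it is a limit of directions g along which u strictly
   decreases. Since Hadamard's limit is joint in the step and the direction,
   f'_H(x, h) < 0 would make f strictly decrease along some such g, which is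
   feasible; hence f'_H(x, h) >= 0, and the member D of the lower exhauster
   attaining it satisfies min_(w in D) <w, h> >= 0. *)

Require Import Defs.
From HB Require Import structures.
From mathcomp Require Import all_boot all_order all_algebra.
From mathcomp Require Import all_classical all_reals all_analysis.

Import Order.TTheory GRing.Theory Num.Theory.
Import numFieldNormedType.Exports.

Local Open Scope classical_set_scope.
Local Open Scope ring_scope.

Set Implicit Arguments.
Unset Strict Implicit.
Unset Printing Implicit Defensive.

Lemma dot_continuousl (R : realType) (n : nat) (g : 'rV[R]_n) :
  continuous (fun v => dot v g).
Proof.
move=> v; apply: (@cvg_big _ _ +%R 0 _ _ _ (nbhs v)) => [|i _].
  exact: add_continuous.
apply: (@cvgM _ _ (nbhs v)); last exact: cvg_cst.
exact: coord_continuous.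
Qed.

(** As [dot] is linear in its first argument, a sign condition on [C] passes to nonnegative
    combinations, so the conic hull can be forgotten. *)
Lemma Kplus_dotP (R : realType) (n : nat) (C : set 'rV[R]_n) (g : 'rV[R]_n) :
  Kplus C g <-> forall v, C v -> 0 <= dot v g.
Proof.
split=> [Kg v Cv|Cg _ [k [a [v [a0 Cv ->]]]]].
  apply: Kg; exists 1%N, (fun=> 1), (fun=> v); split=> //.
  by rewrite big_ord1 scale1r.
have -> : dot (\sum_(i < k) a i *: v i) g = \sum_(i < k) a i * dot (v i) g.
  rewrite /dot; under [RHS]eq_bigr do rewrite mulr_sumr.
  rewrite [RHS]exchange_big; apply: eq_bigr => j _ /=.
  by rewrite summxE mulr_suml; apply: eq_bigr => i _; rewrite !mxE mulrA.
by apply: sumr_ge0 => i _; rewrite mulr_ge0 ?Cg.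
Qed.

(** The joint limit makes the quotient negative on a product [A] times [B] of neighbourhoods; [B]
    leaves room to perturb the direction. *)
Lemma hadamard_derive_lt0 (R : realType) (n : nat) (phi : 'rV[R]_n -> R)
    (x g : 'rV[R]_n) :
  hadamard_differentiable phi x -> hadamard_derive phi x g < 0 ->
  \forall h \near g, \forall a \near (0 : R)^'+, phi (x + a *: h) < phi x.
Proof.
move=> /(_ g) phig phig0.
have [[A B] /= [A0 Bg] AB] := cvgr_lt _ phig _ phig0.
near=> h; near=> a.
have a0 : 0 < a by near: a; exact: nbhs_right_gt.
have : diff_quotient phi x (a, h) < 0.
  by apply: AB; split => /=; [near: a|near: h].
by rewrite /diff_quotient/= pmulr_llt0 ?invr_gt0// subr_lt0.
Unshelve. all: by end_near. Qed.

Lemma hadamard_derive_ge0 (R : realType) (n : nat) (f u : 'rV[R]_n -> R)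
    (x h : 'rV[R]_n) :
  hadamard_differentiable f x -> hadamard_differentiable u x ->
  local_minimum_on f [set y | u y <= 0] x -> closure (K_lt u x) h ->
  0 <= hadamard_derive f x h.
Proof.
move=> df du [/= ux0 fmin] clh; rewrite leNgt; apply/negP => fh0.
(* The directions along which [f] decreases form a neighbourhood of [h], which therefore meets
   [K_lt u x]. *)
have [g [/= ug0 fg]] := clh _ (hadamard_derive_lt0 df fh0).
have := nbhs_singleton (hadamard_derive_lt0 du ug0) => ug.
have xg : x + a *: g @[a --> (0 : R)^'+] --> x.
  rewrite -[X in _ --> X]addr0 -(scale0r g).
  apply: cvgD; first exact: cvg_cst.
  by apply: cvg_at_right_filter; exact: scalel_continuous.
(* One small step [a] makes [x + a *: g] feasible, close enough to [x] for minimality to apply, and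
   strictly better for [f]. *)
near ((0 : R)^'+) => a.
have : f (x + a *: g) < f x by near: a.
rewrite ltNge => /negP; apply.
have : u (x + a *: g) <= 0.
  by apply: ltW; apply: lt_le_trans ux0; near: a.
by near: a; exact: xg _ fmin.
Unshelve. all: by end_near. Qed.

Theorem theorem10 (R : realType) (n : nat) (f u : 'rV[R]_n -> R)
    (xs : 'rV[R]_n) (Ef Eu : set (set 'rV[R]_n))
    (f_diff : forall x, hadamard_differentiable f x)
    (u_diff : forall x, hadamard_differentiable u x)
    (xs_Omega : [set x | u x <= 0] xs)
    (regularity : closure (K_lt u xs) = K_le u xs)
    (Ef_lower : lower_exhauster f xs Ef)
    (Eu_upper : upper_exhauster u xs Eu)
    (xs_min : local_minimum_on f [set x | u x <= 0] xs) :
  \bigcup_(C in Eu) [set - g | g in Kplus C] `<=` \bigcup_(C in Ef) Kplus C.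
Proof.
move=> _ [C EuC [g /Kplus_dotP Cg <-]].
have dotN v : dot v (- g) = - dot v g.
  by rewrite /dot -sumrN; apply: eq_bigr => i _; rewrite mxE mulrN.
have uNg : K_le u xs (- g).
  have [/(_ _ EuC)[C0 _ cC] _] := Eu_upper.1.
  (* Compactness makes the maximum over [C] attained, so it is one of the values whose minimum is
     the derivative of [u]. *)
  have [v /set_mem Cv vmax] := compact_EVT_max C0 cC
    (continuous_subspaceT (@dot_continuousl _ _ (- g))).
  apply: (@le_trans _ _ (dot v (- g))); last by rewrite dotN oppr_le0 Cg.
  apply: (Eu_upper.2 (- g)).2; exists C => //; split; first by exists v.
  by move=> _ [w Cw <-]; exact/vmax/mem_set.
rewrite -regularity in uNg.
have fNg0 := hadamard_derive_ge0 (f_diff xs) (u_diff xs) xs_min uNg.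
have [[D EfD [_ Dmin]] _] := Ef_lower.2 (- g).
exists D => //; apply/Kplus_dotP => v Dv.
by apply: le_trans fNg0 (Dmin _ _); exists v.
Qed.
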